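(* Let $\mathfrak{A}$ be a residuated lattice. Then $(Min(\mathfrak{A});\tau_h)$ is a Stonean space if and only if $\mathfrak{A}$ is a $\bigstar$-residuated lattice.
   Context: A residuated lattice is an algebra $\mathfrak{A}=(A;\vee,\wedge,\odot,\rightarrow,0,1)$ such that $(A;\vee,\wedge,0,1)$ is a bounded lattice, $(A;\odot,1)$ is a commutative monoid, and $(\odot,\rightarrow)$ is an adjoint pair, i.e. $x\odot y\le z$ iff $x\le y\rightarrow z$. A filter of $\mathfrak{A}$ is a non-empty subset $F\subseteq A$ such that $x,y\in F$ implies $x\odot y\in F$, and $x\in F$, $y\in A$ imply $x\vee y\in F$. A filter is proper if it is not equal to $A$. A proper filter $P$ is prime if for all filters $F_1,F_2$, $F_1\cap F_2=P$ implies $F_1=P$ or $F_2=P$. $Min(\mathfrak{A})$ is the set of minimal prime filters (minimal elements, under inclusion, among all prime filters). For $X\subseteq A$ let $X^{\perp}=\{a\in A\mid x\vee a=1 \text{ for all } x\in X\}$ and $y^\perp=\{y\}^\perp$. $\mathfrak{A}$ is a $\bigstar$-residuated lattice if for every subset $X$ of $A$ there exists $y\in A$ such that $X^{\perp}=y^{\perp}$. The hull-kernel topology $\tau_h$ on $Min(\mathfrak{A})$ is the topology whose closed sets are the sets $h(X)=\{P\in Min(\mathfrak{A})\mid X\subseteq P\}$, $X\subseteq A$. A Stonean space is a compact Hausdorff space that is extremally disconnected, i.e. in which the closure of every open set is open. *)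

(* Defs.v *)
From HB Require Import structures.
From mathcomp Require Import all_boot all_order.
From mathcomp Require Import all_classical.
From mathcomp Require Import topology.

Set Implicit Arguments.
Unset Strict Implicit.
Unset Printing Implicit Defensive.

Import Order.Theory.
Local Open Scope classical_set_scope.
Local Open Scope order_scope.

(* The unit of the monoid is the top element of the lattice. [tbLatticeType]
   does not require \bot != \top, so the one-element algebra is included. *)
HB.mixin Record isResiduated d T of Order.TBLattice d T := {
  odot : T -> T -> T;
  residual : T -> T -> T;
  odotA : associative odot;
  odotC : commutative odot;
  odot1x : left_id \top odot;
  odot_adj : forall x y z : T, (odot x y <= z) = (x <= residual y z)
}.

#[short(type="residuatedLatticeType")]
HB.structure Definition ResiduatedLattice d :=
  { T of isResiduated d T & Order.TBLattice d T }.

Section Definitions.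
Context {d : Order.disp_t} {A : residuatedLatticeType d}.
Implicit Types F P X : set A.

Definition lfilter F : Prop :=
  [/\ F !=set0,
      forall x y, F x -> F y -> F (odot x y) &
      forall x y, F x -> F (x `|` y)].

Definition proper_lfilter F : Prop := lfilter F /\ F <> [set: A].

Definition prime_lfilter P : Prop :=
  proper_lfilter P /\
  forall F1 F2, lfilter F1 -> lfilter F2 ->
    (F1 `&` F2)%classic = P -> F1 = P \/ F2 = P.

Definition minimal_prime_lfilter P : Prop :=
  prime_lfilter P /\
  forall Q : set A, prime_lfilter Q -> (Q `<=` P)%classic -> Q = P.

Definition coannihilator X : set A :=
  [set a | forall x, X x -> x `|` a = \top].

End Definitions.

Definition star_residuated_lattice d (A : residuatedLatticeType d) : Prop :=
  forall X : set A, exists y : A, coannihilator X = coannihilator [set y].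

(* A named copy of the subtype, so that the hull-kernel topology is its only
   topology. *)
Definition Min d (A : residuatedLatticeType d) : Type :=
  set_type [set P : set A | minimal_prime_lfilter P].

HB.instance Definition _ d (A : residuatedLatticeType d) :=
  Choice.copy (Min A) (set_type [set P : set A | minimal_prime_lfilter P]).

Definition min_filter d (A : residuatedLatticeType d) (P : Min A) : set A :=
  set_val P.

Definition hull d (A : residuatedLatticeType d) (X : set A) : set (Min A) :=
  [set P | (X `<=` min_filter P)%classic].

Definition hk_open d (A : residuatedLatticeType d) : set_system (Min A) :=
  [set U | exists X : set A, U = (~` hull X)%classic].

Section HullKernel.
Context {d : Order.disp_t} {A : residuatedLatticeType d}.
Implicit Types (x y z a b : A) (F P : set A).

Lemma odotx1 x : odot x \top = x.
Proof. by rewrite odotC odot1x. Qed.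

Lemma odot_monol z x y : x <= y -> odot x z <= odot y z.
Proof. by move=> xy; rewrite odot_adj (le_trans xy)// -odot_adj. Qed.

Lemma odot_mono x y z t : x <= y -> z <= t -> odot x z <= odot y t.
Proof.
move=> xy zt; apply: le_trans (odot_monol z xy) _.
by rewrite odotC (odotC y); exact: odot_monol.
Qed.

Lemma odot_lel x y : odot x y <= x.
Proof. by rewrite -[leRHS]odotx1; apply: odot_mono; rewrite ?lexx ?lex1. Qed.

Lemma odot_ler x y : odot x y <= y.
Proof. by rewrite odotC odot_lel. Qed.

Lemma odot_joinl x y z : odot (x `|` y) z = odot x z `|` odot y z.
Proof.
apply/eqP; rewrite eq_le; apply/andP; split.
  by rewrite odot_adj leUx -!odot_adj leUl leUr.
by rewrite leUx !odot_monol ?leUl ?leUr.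
Qed.

Lemma lfilter_up F x y : lfilter F -> F x -> x <= y -> F y.
Proof. by case=> _ _ FU Fx /join_idPl <-; rewrite joinC; exact: FU. Qed.

Lemma lfilter_top F : lfilter F -> F \top.
Proof. by move=> FF; case: (FF) => -[x Fx] _ _; exact: lfilter_up Fx (lex1 x). Qed.

Definition opow x n : A := iter n (odot x) \top.

Lemma opowD x m n : opow x (m + n) = odot (opow x m) (opow x n).
Proof. by elim: m => [|m IH] /=; rewrite ?odot1x// -/(opow _ _) IH odotA. Qed.

Lemma opow_join x y m n : opow (x `|` y) (m + n) <= opow x m `|` opow y n.
Proof.
have key u z t k : u <= z `|` opow t k -> odot t u <= z `|` opow t k.+1.
  move=> /(odot_monol t); rewrite odotC => /le_trans; apply.
  by rewrite odot_joinl leU2 ?odot_lel// odotC.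
elim: m n => [|m IHm] n; first by rewrite (le_trans (lex1 _)) ?leUl.
elim: n => [|n IHn]; first by rewrite (le_trans (lex1 _)) ?leUr.
rewrite addSn [opow _ _.+1]/= -/(opow _ _) odot_joinl leUx; apply/andP; split.
  rewrite [leRHS]joinC; apply: key.
  by rewrite [leRHS]joinC; exact: IHm.
by apply: key; rewrite addnS -addSn; exact: IHn.
Qed.

Definition lfilter_adj F x : set A :=
  [set a | exists2 p, F p & exists n, odot p (opow x n) <= a].

Lemma lfilter_adjP F x : lfilter F -> lfilter (lfilter_adj F x).
Proof.
move=> FF; have [_ FM _] := FF; split.
- by exists \top, \top; [exact: lfilter_top | exists 0%N; rewrite lex1].
- move=> a b [p Fp [m pa]] [q Fq [n qb]]; exists (odot p q); first exact: FM.
  exists (m + n)%N; rewrite opowD.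
  suff -> : odot (odot p q) (odot (opow x m) (opow x n)) =
            odot (odot p (opow x m)) (odot q (opow x n)) by exact: odot_mono.
  by rewrite -!odotA; congr odot; rewrite !odotA (odotC q).
- move=> a b [p Fp [n pa]]; exists p => //; exists n.
  exact: le_trans pa (leUl _ _).
Qed.

Lemma lfilter_adj_sub F x : (F `<=` lfilter_adj F x)%classic.
Proof. by move=> a Fa; exists a => //; exists 0%N; rewrite odotx1. Qed.

Lemma lfilter_adj_mem F x : lfilter F -> lfilter_adj F x x.
Proof.
move=> FF; exists \top; first exact: lfilter_top.
by exists 1%N; rewrite odot1x /opow /= odotx1.
Qed.

Lemma prime_lfilter_join P x y :
  prime_lfilter P -> P (x `|` y) -> P x \/ P y.
Proof.
move=> [[FP _] primeP] Pxy; have [_ PM _] := FP.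
have PX n : P (opow (x `|` y) n).
  by elim: n => [|n IH]; [exact: lfilter_top | exact: PM].
have [|||E|E] := primeP (lfilter_adj P x) (lfilter_adj P y).
- exact: lfilter_adjP.
- exact: lfilter_adjP.
- apply/seteqP; split=> a; last by move=> Pa; split; exact: lfilter_adj_sub.
  move=> [[p Pp [m pa]] [q Pq [n qa]]].
  apply: (@lfilter_up P (odot (odot p q) (opow (x `|` y) (m + n)))) => //.
    by apply: (PM) => //; exact: PM.
  apply: le_trans (odot_mono (lexx _) (opow_join _ _ _ _)) _.
  rewrite odotC odot_joinl leUx; apply/andP; split; rewrite odotC.
    by apply: le_trans pa; apply: odot_monol; exact: odot_lel.
  by apply: le_trans qa; apply: odot_monol; exact: odot_ler.
- by left; rewrite -E; exact: lfilter_adj_mem.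
- by right; rewrite -E; exact: lfilter_adj_mem.
Qed.

Lemma min_filterP (P : Min A) : minimal_prime_lfilter (min_filter P).
Proof. by have := set_valP P. Qed.

Lemma hk_openT : hk_open [set: Min A].
Proof.
exists [set: A]; apply/esym; rewrite -subTset => P _ TP.
by have [[[_ []]]] := min_filterP P; apply/seteqP.
Qed.

Lemma hk_openI : setI_closed (@hk_open d A).
Proof.
move=> _ _ [X ->] [Y ->].
exists [set z | exists2 x, X x & exists2 y, Y y & z = x `|` y].
rewrite -setCU; congr setC; apply/seteqP; split=> P.
  have [[[[_ _ PU] _] _] _] := min_filterP P.
  move=> [XP|YP] _ [x Xx [y Yy ->]]; first by apply: PU; exact: XP.
  by rewrite joinC; apply: PU; exact: YP.
move=> XYP; apply: contrapT => /not_orP[/existsNP[x /not_implyP[Xx nPx]]].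
move=> /existsNP[y /not_implyP[Yy nPy]].
have [pP _] := min_filterP P.
have Pxy : min_filter P (x `|` y) by apply: XYP; exists x => //; exists y.
by case: (prime_lfilter_join pP Pxy).
Qed.

Lemma hk_open_bigU (I : Type) (f : I -> set (Min A)) :
  (forall i, hk_open (f i)) -> hk_open (\bigcup_i f i).
Proof.
move=> /choice[X fE]; exists (\bigcup_i X i)%classic.
rewrite (_ : f = fun i => (~` hull (X i))%classic); last exact/funext.
rewrite -setC_bigcap; congr setC; apply/seteqP; split=> P.
  by move=> XP a [i _ Xa]; exact: (XP i Logic.I).
by move=> XP i _ a Xa; apply: XP; exists i.
Qed.

End HullKernel.

HB.instance Definition _ d (A : residuatedLatticeType d) :=
  isOpenTopological.Build (Min A) hk_openT hk_openI (@hk_open_bigU d A).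

Lemma closed_hullP d (A : residuatedLatticeType d) (C : set (Min A)) :
  closed C <-> exists X : set A, C = hull X.
Proof.
rewrite -openC; split=> [[X CX]|[X ->]]; last by exists X.
by exists X; rewrite -[LHS]setCK CX setCK.
Qed.

Definition extremally_disconnected (T : topologicalType) : Prop :=
  forall U : set T, open U -> open (closure U).

Definition stonean_space (T : topologicalType) : Prop :=
  [/\ compact [set: T], hausdorff_space T & extremally_disconnected T].

(* Main.v *)
Require Import Defs.
From mathcomp Require Import all_boot all_order.
From mathcomp Require Import all_classical.
From mathcomp Require Import topology.

(** The complement of a maximal proper lattice ideal is a minimal prime filter,
    and conversely; hence a prime filter [P] is minimal iff every [x] in [P] has
    a [y] outside [P] with [x \/ y = 1].  This makes every [D(x)], the set of
    minimal primes avoiding [x], clopen, so the space is always Hausdorff, and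
    the union [D(X)] of the [D(x)] for [x] in [X] has closure [h(X^perp)].
    In a star algebra, [x^perp^perp = x'^perp] for some [x'], and [x'] lies in
    [P] iff [x] does not; so for an ultrafilter on the space the set of all [x]
    with [h(x)] in the ultrafilter is a minimal prime, its limit.  Moreover
    [h(X^perp) = h(y^perp) = D(y)] is open.  Conversely, in a Stonean space the
    clopen set [h(X^perp)] is compact, hence equal to some [D(y)], and then
    [X^perp = y^perp]. *)

Set Implicit Arguments.
Unset Strict Implicit.
Unset Printing Implicit Defensive.

Import Order.Theory.
Local Open Scope classical_set_scope.
Local Open Scope order_scope.

(** * Minimal prime filters as complements of maximal lattice ideals *)

Section MinimalPrimes.
Context {d : Order.disp_t} {A : residuatedLatticeType d}.
Implicit Types (x y z a b : A) (P Q I J X : set A).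

(** If two filters meeting in [P] were both larger, the join of an element of each outside [P] would
    lie in both, against [joinP]. For minimality, a prime [Q] inside [P] contains [x \/ y = 1] but
    not the witness [y], so it contains [x]. *)
Lemma minimal_prime_lfilter_witness P :
  lfilter P -> (forall x y, P (x `|` y) -> P x \/ P y) ->
  (forall x, P x -> exists2 y, ~ P y & x `|` y = \top) ->
  minimal_prime_lfilter P.
Proof.
move=> FP joinP witP.
have properP : proper_lfilter P.
  split=> // PT; have [|y []//] := witP \bot; first by rewrite PT.
  by rewrite PT.
split.
  split=> // F1 F2 FF1 FF2 F12.
  have P1 : (P `<=` F1)%classic by rewrite -F12 => x [].
  have P2 : (P `<=` F2)%classic by rewrite -F12 => x [].
  apply: contrapT => /not_orP[nF1 nF2].
  have [x F1x nPx] : exists2 x, F1 x & ~ P x.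
    apply: contrapT => /exists2P/forallNP H; apply: nF1.
    apply/seteqP; split=> // x F1x.
    by apply: contrapT => nPx; exact: (H x).
  have [y F2y nPy] : exists2 y, F2 y & ~ P y.
    apply: contrapT => /exists2P/forallNP H; apply: nF2.
    apply/seteqP; split=> // y F2y.
    by apply: contrapT => nPy; exact: (H y).
  have [] : P x \/ P y; [|by []..].
  apply: joinP; rewrite -F12; split.
    by have [_ _] := FF1; apply.
  by rewrite joinC; have [_ _] := FF2; apply.
move=> Q pQ QP; apply/seteqP; split=> // x Px.
have [y nPy xy] := witP x Px.
have [|//|/QP//] := prime_lfilter_join (x := x) (y := y) pQ.
by rewrite xy; apply: lfilter_top; case: pQ => -[].
Qed.

Definition proper_ideal I :=
  [/\ I \bot, (forall x y, x <= y -> I y -> I x),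
      (forall x y, I x -> I y -> I (x `|` y)) & ~ I \top].

Lemma maximal_proper_ideal I : proper_ideal I ->
  exists J, [/\ proper_ideal J, (I `<=` J)%classic &
    forall K, proper_ideal K -> (J `<=` K)%classic -> K = J].
Proof.
move=> [I0 Idown Ijoin I1].
(* The empty set is allowed so that the empty chain has an upper bound. *)
pose ext J := [/\ (J !=set0 -> (I `<=` J)%classic),
  (forall x y, x <= y -> J y -> J x),
  (forall x y, J x -> J y -> J (x `|` y)) & ~ J \top].
have [F Fext Ftot|J [extJ maxJ]] := @Zorn_bigcup A ext.
  split.
  - move=> [x [X FX Xx]] i Ii; exists X => //.
    by have [+ _ _ _] := Fext _ FX; apply=> //; exists x.
  - move=> x y xy [X FX Xy]; exists X => //.
    by have [_ + _ _] := Fext _ FX; apply; [exact: xy|].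
  - move=> x y [X FX Xx] [Y FY Yy].
    have [XY|YX] := Ftot _ _ FX FY.
      exists Y => //; have [_ _ + _] := Fext _ FY; apply=> //; exact: XY.
    exists X => //; have [_ _ + _] := Fext _ FX; apply=> //; exact: YX.
  - by move=> [X FX XT]; have [] := Fext _ FX.
(* An empty [J] would be strictly contained in [I], against maximality. *)
have J0 : J !=set0.
  apply: contrapT => nJ0; apply: (maxJ I); last by split=> // _ x.
  split=> [x Jx|IJ]; first by case: nJ0; exists x.
  by apply: nJ0; exists \bot; exact: IJ.
have [extI Jdown Jjoin J1] := extJ; have IJ := extI J0.
exists J; split=> //; first by split=> //; exact: IJ.
move=> K [K0 Kdown Kjoin K1] JK; apply: contrapT => KJ.
apply: (maxJ K); last by split=> // _; exact: subset_trans JK.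
by split=> // KJ'; apply: KJ; apply/seteqP.
Qed.

Lemma exists_minimal_prime_lfilter I : proper_ideal I ->
  exists2 P, minimal_prime_lfilter P /\ (P `&` I = set0)%classic &
    forall x, P x -> exists2 y, ~ P y & x `|` y = \top.
Proof.
move=> /maximal_proper_ideal[J [[J0 Jdown Jjoin J1] IJ maxJ]].
have witJ x : ~ J x -> exists2 y, J y & x `|` y = \top.
  move=> nJx; apply: contrapT => noy.
  (* The ideal generated by [J] and [x]; it is proper as long as no [y] in [J] satisfies
     [x \/ y = 1]. *)
  pose K : set A := [set a | exists2 y, J y & a <= x `|` y].
  have KJ : K = J.
    apply: maxJ => [|y Jy]; last by exists y; rewrite ?leUr.
    split.
    - by exists \bot; rewrite ?le0x.
    - by move=> a b ab [y Jy by_]; exists y => //; exact: le_trans by_.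
    - move=> a b [y Jy ay] [z Jz bz]; exists (y `|` z); first exact: Jjoin.
      rewrite leUx (le_trans ay) ?(le_trans bz)//.
        by rewrite joinA leU2 ?leUl.
      by rewrite leU2 ?leUl.
    - move=> [y Jy]; rewrite le1x => /eqP xy; by apply: noy; exists y.
  by apply: nJx; rewrite -KJ; exists \bot => //; exact: leUl.
have FJ : lfilter (~` J)%classic.
  split.
  - by exists \top.
  (* Here 1 is the product of [x \/ i] and [y \/ j], which lies below the join of [odot x y], [i]
     and [j]; if [odot x y] were in [J], so would be 1. *)
  - move=> x y /witJ[i Ji xi] /witJ[j Jj yj] Jxy.
    have le1 z k : odot (x `|` i) z <= odot x z `|` (i `|` k).
      by rewrite odot_joinl leU2// (le_trans (odot_lel _ _)) ?leUl.
    apply: J1; apply: (Jdown _ (odot x y `|` (i `|` j))); last first.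
      by apply: (Jjoin) => //; exact: Jjoin.
    have := le1 \top j; rewrite xi odotx1 odotx1 -{1}yj => le2.
    rewrite -[leLHS]yj; have := le1 (y `|` j) j.
    rewrite xi odot1x => /le_trans; apply.
    rewrite leUx; apply/andP; split; last exact: leUr.
    rewrite odotC odot_joinl leUx odotC leUl/=.
    by rewrite (le_trans (odot_lel _ _))// joinA leUr.
  - by move=> x y nJx Jxy; apply: nJx; apply: Jdown Jxy; rewrite leUl.
have wit x : (~` J)%classic x -> exists2 y, ~ (~` J)%classic y & x `|` y = \top.
  by move=> /witJ[y Jy xy]; exists y => // nJy; exact: nJy.
exists (~` J)%classic => //; split.
  apply: minimal_prime_lfilter_witness => // x y nJxy.
  apply: contrapT => /not_orP[/contrapT Jx /contrapT Jy].
  by apply: nJxy; exact: Jjoin.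
by apply/seteqP; split=> x // [nJx /IJ].
Qed.

End MinimalPrimes.

(** * Topology of the space of minimal prime filters *)

Section HullKernelSpace.
Context {d : Order.disp_t} {A : residuatedLatticeType d}.
Implicit Types (x y z a b : A) (P Q : Min A) (X : set A).

Lemma min_filter_inj : injective (@min_filter d A).
Proof. by move=> P Q PQ; exact: val_inj. Qed.

Lemma min_filter_surj (F : set A) :
  minimal_prime_lfilter F -> exists P, min_filter P = F.
Proof. by move=> mF; exists (exist _ F (mem_set mF)). Qed.

Lemma min_lfilter P : lfilter (min_filter P).
Proof. by have [[[]]] := min_filterP P. Qed.

Lemma min_filter_join P x y :
  min_filter P (x `|` y) <-> min_filter P x \/ min_filter P y.
Proof.
have [pP _] := min_filterP P; split; first exact: prime_lfilter_join.
have [_ _ PU] := min_lfilter P.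
by move=> [|Py]; [exact: PU|rewrite joinC; exact: PU].
Qed.

Lemma min_filter_odot P x y :
  min_filter P (odot x y) <-> min_filter P x /\ min_filter P y.
Proof.
have FP := min_lfilter P; have [_ PM _] := FP.
split=> [Pxy|[]]; last exact: PM.
by split; apply: lfilter_up Pxy _ => //; rewrite ?odot_lel ?odot_ler.
Qed.

Lemma min_filter_bot P : ~ min_filter P \bot.
Proof.
move=> P0; have [[[FP nPT] _] _] := min_filterP P; apply: nPT.
by apply/seteqP; split=> // x _; exact: lfilter_up P0 (le0x x).
Qed.

(** The complement of [P] is a proper ideal. A minimal prime disjoint from it is contained in [P],
    hence equals [P], and it comes with witnesses. *)
Lemma min_filter_witness P x :
  min_filter P x -> exists2 y, ~ min_filter P y & x `|` y = \top.
Proof.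
have [[[FP _] _] minP] := min_filterP P.
have [|Q [mQ QI] witQ] :=
    @exists_minimal_prime_lfilter d A (~` min_filter P)%classic.
  split.
  - exact: min_filter_bot.
  - by move=> a b ab nPb Pa; apply: nPb; exact: lfilter_up ab.
  - by move=> a b nPa nPb /min_filter_join[].
  - by move=> nPT; apply: nPT; exact: lfilter_top.
rewrite -(minP Q) //; first exact: witQ; first by case: mQ.
by apply/subsets_disjoint.
Qed.

(** If [x] is not 1, the principal ideal below [x] is proper, so some minimal prime avoids it. *)
Lemma eq_top_min_filter x : (forall P, min_filter P x) -> x = \top.
Proof.
move=> Px; apply: contrapT => x1.
have [|F [mF FI] _] := @exists_minimal_prime_lfilter d A [set a | a <= x].
  split=> //=.
  - by move=> a b; exact: le_trans.
  - by move=> a b ax bx; rewrite leUx ax.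
  - by rewrite le1x => /eqP.
have [P PF] := min_filter_surj mF.
have : (F `&` [set a | a <= x])%classic x by split; rewrite -?PF//=.
by rewrite FI.
Qed.

Lemma sub_coannihilator1 P y :
  (coannihilator [set y] `<=` min_filter P)%classic <-> ~ min_filter P y.
Proof.
split=> [sP Py|nPy a /(_ y erefl) ya].
  have [z nPz yz] := min_filter_witness Py.
  by apply: nPz; apply: sP => _ ->.
have /min_filter_join[]// : min_filter P (y `|` a).
by rewrite ya; exact: lfilter_top (min_lfilter P).
Qed.

Definition cozero x : set (Min A) := [set P | ~ min_filter P x].

Lemma open_cozero x : open (cozero x).
Proof.
exists [set x]; apply/seteqP; split=> P Px.
  by move=> sP; apply: Px; exact: sP.
by move=> Px'; apply: Px => _ ->.
Qed.

(** Exhibits the basic open set D(y) as a hull, hence as a closed set. *)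
Lemma hull_coannihilator1 y : hull (coannihilator [set y]) = cozero y.
Proof. by apply/seteqP; split=> P /sub_coannihilator1. Qed.

Lemma nbhs_cozero P (B : set (Min A)) :
  nbhs P B <-> exists2 x, ~ min_filter P x & (cozero x `<=` B)%classic.
Proof.
split=> [|[x nPx xB]]; last first.
  by rewrite nbhsE; exists (cozero x) => //; split=> //; exact: open_cozero.
rewrite nbhsE => -[_ [[X ->] XP] XB].
move: XP => /existsNP[x /not_implyP[Xx nPx]].
by exists x => // Q nQx; apply: XB => XQ; apply: nQx; exact: XQ.
Qed.

Lemma hausdorff_Min : hausdorff_space (Min A).
Proof.
move=> P Q PQ; apply/esym/min_filter_inj.
have [pQ _] := min_filterP Q; have [_ minP] := min_filterP P.
apply: minP => // x Qx; apply: contrapT => nPx.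
have [y nQy xy] := min_filter_witness Qx.
(* D(x) and D(y) are disjoint because [x \/ y = 1], yet they are neighbourhoods of [P] and [Q]. *)
have [|| R [nRx nRy]] := PQ (cozero x) (cozero y).
- by apply/nbhs_cozero; exists x.
- by apply/nbhs_cozero; exists y.
have /min_filter_join[]// : min_filter R (x `|` y).
by rewrite xy; exact: lfilter_top (min_lfilter R).
Qed.

Lemma bigcap_setC_hull X :
  (\bigcap_(P in ~` hull X) min_filter P = coannihilator X)%classic.
Proof.
apply/seteqP; split=> a.
  move=> aX x Xx; apply: eq_top_min_filter => P; apply/min_filter_join.
  have [|nPx] := EM (min_filter P x); [by left|right].
  by apply: aX => XP; apply: nPx; exact: XP.
move=> aX P /existsNP[x /not_implyP[Xx nPx]].
have /min_filter_join[]// : min_filter P (x `|` a).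
by rewrite aX//; exact: lfilter_top (min_lfilter P).
Qed.

Lemma closure_hull (U : set (Min A)) :
  closure U = hull (\bigcap_(P in U) min_filter P)%classic.
Proof.
apply/seteqP; split=> P.
  move=> clP a aU; apply: contrapT => nPa.
  have [|Q [UQ nQa]] := clP (cozero a); first by apply/nbhs_cozero; exists a.
  by apply: nQa; exact: aU.
move=> hP B /nbhs_cozero[x nPx xB]; apply: contrapT => UB.
apply: nPx; apply: hP => Q UQ; apply: contrapT => nQx.
by apply: UB; exists Q; split=> //; exact: xB.
Qed.

Lemma closure_setC_hull X : closure (~` hull X)%classic = hull (coannihilator X).
Proof. by rewrite closure_hull bigcap_setC_hull. Qed.

Lemma coannihilator1E y :
  coannihilator [set y] = (\bigcap_(P in cozero y) min_filter P)%classic.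
Proof.
rewrite -bigcap_setC_hull; congr bigcap.
apply/seteqP; split=> P nP Py; apply: nP; [by move=> _ ->|exact: Py].
Qed.

(** Take [y] with x^perp^perp = y^perp. If [P] contained both [x] and [y], their witnesses outside
    [P] would lie in x^perp and x^perp^perp, so their join would be 1. And [x] lies in x^perp^perp,
    so [y \/ x = 1]. *)
Lemma star_complement x : star_residuated_lattice A ->
  exists y, forall P, min_filter P y <-> ~ min_filter P x.
Proof.
move=> /(_ (coannihilator [set x]))[y xy]; exists y => P; split.
  move=> Py Px; have [z nPz xz] := min_filter_witness Px.
  have [t nPt yt] := min_filter_witness Py.
  have tx : coannihilator (coannihilator [set x]) t by rewrite xy => _ ->.
  have zt : z `|` t = \top by apply: tx => _ ->.
  have /min_filter_join[]// : min_filter P (z `|` t).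
  by rewrite zt; exact: lfilter_top (min_lfilter P).
move=> nPx; have : coannihilator (coannihilator [set x]) x.
  by move=> a /(_ x erefl); rewrite joinC.
rewrite xy => /(_ y erefl) yx.
have /min_filter_join[]// : min_filter P (y `|` x).
by rewrite yx; exact: lfilter_top (min_lfilter P).
Qed.

Lemma star_compact : star_residuated_lattice A -> compact [set: Min A].
Proof.
move=> starA; rewrite compact_ultra => U UU _.
have UP : ProperFilter U by exact: ultra_proper.
pose F : set A := [set x | U [set P | min_filter P x]].
have FF : lfilter F.
  split.
  - exists \top; apply: filterS filterT => P _ /=.
    exact: lfilter_top (min_lfilter P).
  - move=> x y Fx Fy; apply: filterS (filterI Fx Fy) => P [? ?] /=.
    exact/min_filter_odot.
  - by move=> x y; apply: filterS => P Px; apply/min_filter_join; left.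
have nF x y : (forall P, min_filter P x -> ~ min_filter P y) -> F x -> ~ F y.
  move=> xy Fx Fy.
  have /filter_ex[P [Px Py]] :
      U ([set P | min_filter P x] `&` [set P | min_filter P y])%classic.
    exact: filterI.
  exact: xy Px Py.
have FVC x : F x \/ U (cozero x).
  by have [|] := in_ultra_setVsetC [set P | min_filter P x] UU; [left|right].
have [|P PF] := @min_filter_surj F.
  apply: minimal_prime_lfilter_witness => //.
    move=> x y Fxy; have [|Ux] := FVC x; [by left|right].
    by apply: filterS (filterI Ux Fxy) => P [nPx /min_filter_join[]].
  (* The complement of [x] is the witness: h(x) and h(y) are disjoint, so they are not both in [U],
     and together they cover the space. *)
  move=> x Fx; have [y yP] := star_complement x starA; exists y.
    by apply: (nF x) => // P Px /yP.
  apply: eq_top_min_filter => P; apply/min_filter_join.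
  by have [|/yP] := EM (min_filter P x); [left|right].
exists P; split=> // B /nbhs_cozero[x nPx xB]; apply: filterS xB _.
by have [|//] := FVC x; rewrite -PF.
Qed.

(** Let [F] be the intersection of the primes outside [U]. The sets D(z) for [z] in [F] lie inside
    [U], cover it, and form a directed family, since D(z) grows as [z] decreases and [F] is closed
    under [odot]. By compactness a single one equals [U]. *)
Lemma compact_open_cozero (U : set (Min A)) :
  open U -> compact U -> exists y, U = cozero y.
Proof.
move=> [X UX] /compact_near_coveringP cU.
pose F : set A := (\bigcap_(P in ~` U) min_filter P)%classic.
(* Convergence downwards along [F], the index filter for the near-covering form of compactness. *)
pose G := filter_from F (fun z => [set y | y <= z]).
have FG : Filter G.
  apply: filter_from_filter.
    by exists \top => P _; exact: lfilter_top (min_lfilter P).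
  move=> x y Fx Fy; exists (odot x y).
    by move=> P UP; apply/min_filter_odot; split; [exact: Fx|exact: Fy].
  by move=> z zxy; split; apply: le_trans zxy _; rewrite ?odot_lel ?odot_ler.
have [|z Fz zU] := cU A G (fun y P => cozero y P) FG.
  move=> P UP.
  have [x Xx nPx] : exists2 x, X x & ~ min_filter P x.
    by move: UP; rewrite UX => /existsNP[x /not_implyP[]]; exists x.
  have Fx : F x by move=> Q; rewrite UX setCK; apply.
  exists (cozero x, [set y | y <= x])%classic.
    by split; [apply/nbhs_cozero; exists x|exists x].
  move=> [Q y] [/= nQx yx] Qy; apply: nQx.
  exact: lfilter_up (min_lfilter Q) Qy yx.
exists z; apply/seteqP; split; first by apply: zU; exact: lexx.
by move=> P nPz; apply: contrapT => nUP; apply: nPz; exact: Fz.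
Qed.

End HullKernelSpace.

Theorem proposition4p10 (d : Order.disp_t) (A : residuatedLatticeType d) :
  stonean_space (Min A) <-> star_residuated_lattice A.
Proof.
split=> [[cA _ edA] X|starA].
  have clX := closure_setC_hull X.
  have [||y Xy] := @compact_open_cozero d A (hull (coannihilator X)).
  - by rewrite -clX; apply: edA; exists X.
  - by apply: subclosed_compact cA _ => //; apply/closed_hullP; eexists.
  (* Both annihilators are intersections of primes: y^perp over D(y) = h(X^perp), and X^perp over
     D(X), which is dense in h(X^perp). *)
  exists y; rewrite coannihilator1E -Xy.
  apply/seteqP; split=> a aX; first by move=> P; exact.
  rewrite -bigcap_setC_hull => P XP; apply: aX.
  by rewrite -clX; exact: subset_closure.
split; [exact: star_compact|exact: hausdorff_Min|].
move=> _ [X ->]; rewrite closure_setC_hull; have [y ->] := starA X.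
by rewrite hull_coannihilator1; exact: open_cozero.
Qed.
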